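(* Let $i\in\{0,\dots,n_{ini}-1\}$ be the index of an initial condition block and $j\ge0$ the index of a downstream boundary condition block, and suppose that $N_{c_{ini}^i}(x_0,t')\ge N_{c_{down}^j}(x_0,t')$ for some time $t'>t_j+\frac{x_{n_{ini}}-x_0}{w}$. Then $$\forall t>t',\qquad N_{c_{ini}^i}(x_0,t)\ge N_{c_{down}^j}(x_0,t).$$
   Context: Fundamental diagram: $Q:[0,k_{jam}]\to[0,\infty)$ is a concave function with $Q(0)=Q(k_{jam})=0$. The free-flow speed is $v_f=Q'(0^+)>0$ and the congested wave speed is $w>0$ with $-w=Q'(k_{jam}^-)$ (both finite). The convex transform of $Q$ is $R(u)=\sup_{k\in[0,k_{jam}]}(Q(k)-uk)$ for $u\in[-w,v_f]$. The road link is the interval $[x_0,x_{n_{ini}}]$ with $x_0<x_1<\dots<x_{n_{ini}}$. For $i\in\{0,\dots,n_{ini}-1\}$ the $i$-th initial condition block, imposed at time $0$, is $c_{ini}^i(x)=-k_ix+b_i$ for $x_i\le x\le x_{i+1}$ and $+\infty$ otherwise. The blocks satisfy $0\le k_i\le k_{jam}$ and are continuous at their common endpoints: $c_{ini}^{i}(x_{i+1})=c_{ini}^{i+1}(x_{i+1})$. With $0=t_0<t_1<t_2<\dots$, the $j$-th downstream boundary condition block, imposed at $x=x_{n_{ini}}$, is $c_{down}^j(t)=p_jt+c_j$ for $t_j\le t\le t_{j+1}$ and $+\infty$ otherwise. The flows satisfy $0\le p_j\le\max Q$ and consecutive blocks agree at their common endpoint. The solution components are given by the Lax-Hopf formula (infimum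 over the empty set equal to $+\infty$): for $x\in[x_0,x_{n_{ini}}]$ and $t>0$, $$N_{c_{ini}^i}(x,t)=\inf\{c_{ini}^i(y)+t\,R(\tfrac{x-y}{t}) : y\in[x_i,x_{i+1}],\ -w\le \tfrac{x-y}{t}\le v_f\},$$ and for $x\in[x_0,x_{n_{ini}})$, $t>0$, $$N_{c_{down}^j}(x,t)=\inf\{c_{down}^j(s)+(t-s)R(\tfrac{x-x_{n_{ini}}}{t-s}) : s\in[t_j,t_{j+1}],\ s<t,\ -w\le\tfrac{x-x_{n_{ini}}}{t-s}\}.$$ *)

(* Defs.v *)
From HB Require Import structures.
From mathcomp Require Import all_boot all_order all_algebra.
From mathcomp Require Import all_classical all_reals all_analysis.

Set Implicit Arguments.
Unset Strict Implicit.
Unset Printing Implicit Defensive.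

Import Order.TTheory GRing.Theory Num.Theory.
Import numFieldNormedType.Exports.

Local Open Scope classical_set_scope.
Local Open Scope ring_scope.

(* [Q] is a total function of which only the values on [0, kjam] matter. The
   one-sided derivatives at the end points are finite limits of difference
   quotients. *)
Record fundamental_diagram (R : realType) (Q : R -> R) (kjam vf w : R) : Prop :=
  FundamentalDiagram {
    fd_kjam_gt0 : 0 < kjam ;
    fd_ge0 : forall k : R, 0 <= k <= kjam -> 0 <= Q k ;
    fd_concave : convex_function (`[0, kjam] : set R^o) (fun k => - Q k) ;
    fd_Q0 : Q 0 = 0 ;
    fd_Qkjam : Q kjam = 0 ;
    fd_vf_gt0 : 0 < vf ;
    fd_vfE : (Q k - Q 0) / (k - 0) @[k --> 0^'+] --> vf ;
    fd_w_gt0 : 0 < w ;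
    fd_wE : (Q k - Q kjam) / (k - kjam) @[k --> kjam^'-] --> - w
  }.

(* For a fundamental diagram, [Q] is continuous on [0, kjam], so the sup below
   is the maximum of [Q]; similarly the sup defining [convex_transform] is that
   of a nonempty set with an upper bound, hence a genuine supremum. *)
Definition max_flow (R : realType) (Q : R -> R) (kjam : R) : R :=
  sup [set Q k | k in `[0, kjam]].

Definition convex_transform (R : realType) (Q : R -> R) (kjam u : R) : R :=
  sup [set Q k - u * k | k in `[0, kjam]].

Definition c_ini (R : realType) (x k b : nat -> R) (i : nat) (y : R) : \bar R :=
  if x i <= y <= x i.+1 then (- k i * y + b i)%:E else +oo%E.

Definition c_down (R : realType) (tm p c : nat -> R) (j : nat) (s : R)
    : \bar R :=
  if tm j <= s <= tm j.+1 then (p j * s + c j)%:E else +oo%E.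

(* The sequences are indexed by [nat], but only [x 0], ..., [x n] and the
   blocks [0], ..., [n - 1] are meaningful. *)
Record initial_condition (R : realType) (kjam : R) (n : nat)
    (x k b : nat -> R) : Prop := InitialCondition {
  ini_increasing : forall i, (i < n)%N -> x i < x i.+1 ;
  ini_density : forall i, (i < n)%N -> 0 <= k i <= kjam ;
  ini_continuous : forall i, (i.+1 < n)%N ->
    c_ini x k b i (x i.+1) = c_ini x k b i.+1 (x i.+1)
}.

Record downstream_condition (R : realType) (Q : R -> R) (kjam : R)
    (tm p c : nat -> R) : Prop := DownstreamCondition {
  down_time0 : tm 0%N = 0 ;
  down_increasing : forall j, tm j < tm j.+1 ;
  down_flow : forall j, 0 <= p j <= max_flow Q kjam ;
  down_continuous : forall j,
    c_down tm p c j (tm j.+1) = c_down tm p c j.+1 (tm j.+1)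
}.

(* Lax-Hopf solution components; [ereal_inf set0 = +oo]. [N_ini] is meant for
   [x 0 <= z <= x n] and [0 < t], [N_down] for [x 0 <= z < xn] and [0 < t],
   where [xn] is the downstream end of the link. *)
Definition N_ini (R : realType) (Q : R -> R) (kjam vf w : R)
    (x k b : nat -> R) (i : nat) (z t : R) : \bar R :=
  ereal_inf
    [set (c_ini x k b i y + (t * convex_transform Q kjam ((z - y) / t))%:E)%E
      | y in [set y | x i <= y <= x i.+1 /\ - w <= (z - y) / t <= vf]].

Definition N_down (R : realType) (Q : R -> R) (kjam w xn : R)
    (tm p c : nat -> R) (j : nat) (z t : R) : \bar R :=
  ereal_inf
    [set (c_down tm p c j s +
           ((t - s) * convex_transform Q kjam ((z - xn) / (t - s)))%:E)%E
      | s in [set s | [/\ tm j <= s <= tm j.+1, s < t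
                        & - w <= (z - xn) / (t - s)]]].

(* Main.v *)
Require Import Defs.
From HB Require Import structures.
From mathcomp Require Import all_boot all_order all_algebra.
From mathcomp Require Import all_classical all_reals all_analysis.
From mathcomp Require Import lra ring.

Set Implicit Arguments.
Unset Strict Implicit.

Import Order.TTheory GRing.Theory Num.Theory.
Import numFieldNormedType.Exports.
Local Open Scope classical_set_scope.
Local Open Scope ring_scope.

(** In the Lax-Hopf formula, a straight trajectory of displacement [e] and
    duration [t] costs [t] times the convex transform of [Q] at [e / t]
    ([travel_cost] below). This is the supremum over the densities [k] of
    [t * Q k - e * k], so its growth rate in [t] is the flow [Q k] at a
    maximizing density, which depends on the mean speed [e / t] only. For
    [e <= 0] this flow is a nondecreasing function of [e / t]: a faster backward
    wave carries a smaller flow.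

    Both components at [x 0] are infima of such costs plus quantities that do
    not depend on the final time. An initial trajectory starts at a point [y] of
    the link, at time 0; a downstream trajectory starts at the far end [x n], at
    a time [s >= 0]. The latter has at least as far to go and at most as much
    time to do so, hence its speed is at most that of the former and its cost
    grows no faster ([travel_cost_growth]). So for each [y] the infimum [N_down] gains between
    [t'] and [t] at most what the cost from [y] gains, and an inequality that
    holds at [t'] remains true at [t].

    The lower bound on [t'] makes every point of the link a legitimate start at
    time [t']: were some [y] within reach of the wave speed [w] at [t] but not
    at [t'], the hypothesis at [t'] would say nothing about it. *)

Definition travel_cost (R : realType) (Q : R -> R) (kjam e t : R) : R :=
  t * convex_transform Q kjam (e / t).

(** Any density [k] lies on one side of [kjam / 2], which is then the convex
    combination of [k] and an end point with weight at least 1/2 on [k]. As [Q]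
    vanishes at the end points and is nonnegative, concavity gives the bound,
    which makes the supremum in [convex_transform] a genuine one. *)
Lemma flow_le_twice_midpoint (R : realType) (Q : R -> R) (kjam vf w k : R) :
  fundamental_diagram Q kjam vf w -> 0 <= k <= kjam ->
  Q k <= 2 * Q (kjam / 2).
Proof.
move=> hQ /andP[k0 kj]; have kjam0 := fd_kjam_gt0 hQ.
have inD (z : R) : 0 <= z -> z <= kjam -> z \in `[0, kjam]%classic.
  by move=> z0 zj; apply/mem_set; rewrite /= in_itv /= z0 zj.
have Qm0 : 0 <= Q (kjam / 2) by apply: (fd_ge0 hQ); apply/andP; split; lra.
(* concavity towards an end point [z], with weight [l] on [k] *)
have toward (z l : R) : 0 <= z -> z <= kjam -> Q z = 0 -> 1/2 <= l -> l <= 1 ->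
    l * k + (1 - l) * z = kjam / 2 -> Q k <= 2 * Q (kjam / 2).
  move=> z0 zj Qz l2 l1 E.
  have l01 : Itv.spec (@Itv.num_sem R) (Itv.Real `[0%Z, 1%Z]) l.
    by rewrite /= /Itv.num_sem /= in_itv /= l1 andbT num_real /=; lra.
  have : - Q (l * k + (1 - l) * z) <= l * - Q k + (1 - l) * - Q z.
    exact: fd_concave hQ (Itv.mk l01) _ _ (inD k k0 kj) (inD z z0 zj).
  rewrite E Qz => H.
  by have := fd_ge0 hQ (k := k); rewrite k0 kj => /(_ isT); nra.
have [km|km] := lerP (kjam / 2) k.
- apply: (toward 0 (kjam / 2 / k)) => //; first exact: ltW.
  + exact: fd_Q0 hQ.
  + by rewrite ler_pdivlMr; lra.
  + by rewrite ler_pdivrMr; lra.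
  + by rewrite mulr0 addr0 divfK //; lra.
- apply: (toward kjam (kjam / 2 / (kjam - k))) => //; first exact: ltW.
  + exact: fd_Qkjam hQ.
  + by rewrite ler_pdivlMr; lra.
  + by rewrite ler_pdivrMr; lra.
  + by field; lra.
Qed.

Lemma travel_cost_ub (R : realType) (Q : R -> R) (kjam vf w e t k : R) :
  fundamental_diagram Q kjam vf w -> 0 < t -> 0 <= k <= kjam ->
  t * Q k - e * k <= travel_cost Q kjam e t.
Proof.
move=> hQ t0 hk.
have -> : t * Q k - e * k = t * (Q k - e / t * k) by field; lra.
rewrite /travel_cost ler_pM2l //; apply: ub_le_sup; last by exists k.
exists (2 * Q (kjam / 2) + `|e / t| * kjam) => _ [l /= + <-].
rewrite in_itv /= => hl.
have Ql := flow_le_twice_midpoint hQ hl; have /andP[l0 lj] := hl.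
have := ler_norm (- (e / t)); rewrite normrN.
by have := normr_ge0 (e / t); nra.
Qed.

Lemma travel_cost_lub (R : realType) (Q : R -> R) (kjam vf w e t M : R) :
  fundamental_diagram Q kjam vf w -> 0 < t ->
  (forall k, 0 <= k <= kjam -> t * Q k - e * k <= M) ->
  travel_cost Q kjam e t <= M.
Proof.
move=> hQ t0 hM; rewrite /travel_cost mulrC -ler_pdivlMr //.
apply: ge_sup.
  exists (Q 0 - e / t * 0), 0 => //=.
  by rewrite in_itv /= lexx (ltW (fd_kjam_gt0 hQ)).
move=> _ [k /= + <-]; rewrite in_itv /= => hk.
rewrite ler_pdivlMr //.
have -> : (Q k - e / t * k) * t = t * Q k - e * k by field; lra.
exact: hM.
Qed.

(** An exchange argument on the suprema. Let [k1] and [k2] be densities tried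
    in the two costs on the left. If [Q k1 <= Q k2], or if [k1 <= k2], then
    these two densities, suitably distributed over the two costs on the right,
    do at least as well. Otherwise [k1] has both the larger flow and the larger
    density; since [e <= 0] it then beats [k2] in [travel_cost e t], and may
    replace it. *)
Lemma travel_cost_growth (R : realType) (Q : R -> R) (kjam vf w : R)
    (e1 e s t h : R) :
  fundamental_diagram Q kjam vf w ->
  e1 <= e -> e <= 0 -> 0 < s -> s <= t -> 0 <= h ->
  travel_cost Q kjam e1 (s + h) + travel_cost Q kjam e t <=
  travel_cost Q kjam e (t + h) + travel_cost Q kjam e1 s.
Proof.
move=> hQ e1e e0 s0 st h0.
rewrite -lerBrDr; apply: (travel_cost_lub hQ); first by lra.
move=> k1 hk1; rewrite lerBrDr -lerBrDl.
apply: (travel_cost_lub hQ); first by lra.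
move=> k2 hk2; rewrite lerBrDl.
have t0 : 0 < t + h by lra.
have far1 := travel_cost_ub e1 hQ s0 hk1.
have far2 := travel_cost_ub e1 hQ s0 hk2.
have near1 := travel_cost_ub e hQ t0 hk1.
have near2 := travel_cost_ub e hQ t0 hk2.
have [Q12|Q21] := lerP (Q k1) (Q k2); first by nra.
have [k12|k21] := lerP k1 k2; last by nra.
have : 0 <= (t - s) * (Q k1 - Q k2) by apply: mulr_ge0; lra.
have : 0 <= (e - e1) * (k2 - k1) by apply: mulr_ge0; lra.
by lra.
Qed.

Lemma node_le (R : realType) (kjam : R) (n : nat) (x k b : nat -> R)
    (i j : nat) :
  initial_condition kjam n x k b -> (i <= j <= n)%N -> x i <= x j.
Proof.
move=> hini; elim: j => [|j IH]; first by rewrite leqn0 => /andP[/eqP->].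
rewrite leq_eqVlt => /andP[/orP[/eqP-> //|ij] jn].
apply: le_trans (ltW (ini_increasing hini jn)).
by apply: IH; rewrite -ltnS ij ltnW.
Qed.

Lemma down_time_ge0 (R : realType) (Q : R -> R) (kjam : R)
    (tm p c : nat -> R) (j : nat) :
  downstream_condition Q kjam tm p c -> 0 <= tm j.
Proof.
move=> hdown; elim: j => [|j IH]; first by rewrite (down_time0 hdown).
exact: le_trans IH (ltW (down_increasing hdown j)).
Qed.

(** Each start time [s] allowed at [t'] is still allowed at [t], so the growth
    bound for the corresponding trajectories passes to the infimum. *)
Lemma N_down_growth (R : realType) (Q : R -> R) (kjam vf w xn z e : R)
    (tm p c : nat -> R) (j : nat) (t' t : R) :
  fundamental_diagram Q kjam vf w -> 0 <= tm j ->
  z - xn <= e -> e <= 0 -> t' <= t ->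
  (N_down Q kjam w xn tm p c j z t <=
   N_down Q kjam w xn tm p c j z t' +
     (travel_cost Q kjam e t - travel_cost Q kjam e t')%:E)%E.
Proof.
move=> hQ tm0 ze e0 tt'; rewrite -leeBlDr //.
apply: le_ereal_inf_tmp => _ [s [hs st' ws] <-].
rewrite leeBlDr //.
apply: (@le_trans _ _ (c_down tm p c j s +
    ((t - s) * convex_transform Q kjam ((z - xn) / (t - s)))%:E)%E).
  apply: ereal_inf_lbound; exists s => //; split => //.
    exact: lt_le_trans tt'.
  move: ws; rewrite !ler_pdivlMr ?subr_gt0 //; last exact: lt_le_trans tt'.
  by have := fd_w_gt0 hQ; nra.
rewrite /c_down hs -!EFinD lee_fin.
have s0 : 0 <= s by case/andP: hs => + _; apply: le_trans.
have -> : t - s = (t' - s) + (t - t') by ring.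
have := @travel_cost_growth R Q kjam vf w (z - xn) e (t' - s) t' (t - t') hQ.
rewrite (_ : t' + (t - t') = t); last by ring.
rewrite /travel_cost => /(_ ze e0); lra.
Qed.

Theorem theorem5 (R : realType) (Q : R -> R) (kjam vf w : R)
    (n : nat) (x k b : nat -> R) (tm p c : nat -> R)
    (hQ : fundamental_diagram Q kjam vf w)
    (hini : initial_condition kjam n x k b)
    (hdown : downstream_condition Q kjam tm p c)
    (i : nat) (hi : (i < n)%N) (j : nat)
    (t' : R) (ht' : tm j + (x n - x 0%N) / w < t')
    (hN : (N_down Q kjam w (x n) tm p c j (x 0%N) t'
             <= N_ini Q kjam vf w x k b i (x 0%N) t')%E) :
  forall t : R, t' < t ->
    (N_down Q kjam w (x n) tm p c j (x 0%N) t
       <= N_ini Q kjam vf w x k b i (x 0%N) t)%E.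
Proof.
move=> t tt'; apply: le_ereal_inf_tmp => _ [y [hy _] <-].
have w0 := fd_w_gt0 hQ; have vf0 := fd_vf_gt0 hQ.
have tm0 := down_time_ge0 j hdown.
have x0y : x 0%N <= y.
  case/andP: (hy) => + _; apply: le_trans.
  by apply: (node_le hini); rewrite leq0n ltnW.
have yxn : y <= x n.
  case/andP: (hy) => _ /le_trans; apply.
  by apply: (node_le hini); rewrite hi leqnn.
have link_lt : x n - x 0%N < t' * w by rewrite -ltr_pdivrMr //; lra.
have t'0 : 0 < t' by rewrite -(pmulr_lgt0 _ w0); lra.
have yN : (N_ini Q kjam vf w x k b i (x 0%N) t' <=
    c_ini x k b i y + (travel_cost Q kjam (x 0%N - y) t')%:E)%E.
  apply: ereal_inf_lbound; exists y => //; split => //.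
  rewrite ler_pdivlMr // ler_pdivrMr //; apply/andP; split; first by lra.
  have := mulr_gt0 vf0 t'0; lra.
apply: le_trans (N_down_growth (e := x 0%N - y) p c hQ tm0 _ _ (ltW tt')) _.
- by lra.
- by lra.
apply: le_trans (leeD2r _ (le_trans hN yN)) _.
by rewrite /c_ini hy -!EFinD lee_fin /travel_cost; lra.
Qed.
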